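(* Let $s_1,s_2,s_3$ be the three roots in $y$ of $K(x,y)=y^3-x(1+xy+y^2)(1+y^2+y^4)$ that vanish as $x\to0$, and set $\Delta=1+s_1s_2s_3(s_1+s_2+s_3)$. Then $$\sum_{n\ge0}\sum_{m\ge0}C^{Q}_{R}(n,m)x^ny^m=\frac{-(s_1-y)(s_2-y)(s_3-y)(1-s_1s_2s_3y)}{\Delta\,K(x,y)},$$ $$\sum_{n\ge0}\sum_{m\ge0}C^{Q}(n,m)x^ny^m=\frac{-(s_1-y)(s_2-y)(s_3-y)}{\Delta\,K(x,y)}\Big(1+\tfrac12\big((s_1+s_2)^2+(s_1+s_3)^2+(s_2+s_3)^2\big)$$ $$\qquad+\big(s_1+s_2+s_3+s_1s_2s_3(s_1s_2+s_1s_3+s_2s_3-1)\big)y+\Delta\,y^2\Big),$$ $$\sum_{n\ge0}C^{Q}_{R}(n,0)x^n=\frac{s_1s_2s_3}{x\Delta},\qquad \sum_{n\ge0}C^{Q}(n,0)x^n=\frac{s_1s_2s_3\Big(1+\tfrac12\big((s_1+s_2)^2+(s_1+s_3)^2+(s_2+s_3)^2\big)\Big)}{x\Delta}.$$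
   Context: A lattice path is a finite sequence of steps (vectors in $\mathbb{Z}^2$) starting at $(0,0)$; its vertices are the partial sums, and it terminates at the last vertex (the empty path terminates at $(0,0)$). Let $S_C=\{(1,1),(1,-1),(2,0)\}$ and $S_{CW}=S_C\cup\{(0,2),(0,-2)\}$; $(0,\pm2)$ are vertical steps. A vertically constrained $S_{CW}$ path is a lattice path with steps in $S_{CW}$ with no two consecutive vertical steps. $C^{Q}(n,m)$ is the number of vertically constrained $S_{CW}$ paths from $(0,0)$ to $(n,m)$ all of whose vertices have $y\ge0$, and $C^{Q}_{R}(n,m)$ the number of those whose first step (if any) lies in $S_C$. *)

(* Defs.v *)
From HB Require Import structures.
From mathcomp Require Import all_boot all_order all_algebra fraction finmap.
From mathcomp Require Import boolp classical_sets cardinality.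

Set Implicit Arguments.
Unset Strict Implicit.
Unset Printing Implicit Defensive.

Import Order.TTheory GRing.Theory Num.Theory.

Local Open Scope ring_scope.

(** Formal power series [R[[z]]], represented by their coefficient sequence.
    [{fraction _}] needs an integral domain, so the ring structure is carried
    up to idomainType; equality and inverses are classical. *)

Record fps (R : Type) := Fps { fcoef : nat -> R }.

Notation "{ 'fps' R }" := (fps R) (at level 0, format "{ 'fps'  R }").

Lemma fpsP (R : Type) (f g : {fps R}) :
  (forall n, fcoef f n = fcoef g n) -> f = g.
Proof. by case: f g => [f] [g] /= fg; congr Fps; apply/funext. Qed.

HB.instance Definition _ (R : Type) := gen_eqMixin {fps R}.
HB.instance Definition _ (R : Type) := gen_choiceMixin {fps R}.

Section FpsZmod.
Variable R : zmodType.
Implicit Types f g h : {fps R}.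

Definition fps_zero : {fps R} := Fps (fun _ => 0).
Definition fps_opp f : {fps R} := Fps (fun n => - fcoef f n).
Definition fps_add f g : {fps R} := Fps (fun n => fcoef f n + fcoef g n).

Fact fps_addA : associative fps_add.
Proof. by move=> f g h; apply: fpsP => n; exact: addrA. Qed.

Fact fps_addC : commutative fps_add.
Proof. by move=> f g; apply: fpsP => n; exact: addrC. Qed.

Fact fps_add0 : left_id fps_zero fps_add.
Proof. by move=> f; apply: fpsP => n; exact: add0r. Qed.

Fact fps_addN : left_inverse fps_zero fps_opp fps_add.
Proof. by move=> f; apply: fpsP => n; exact: addNr. Qed.

HB.instance Definition _ :=
  GRing.isZmodule.Build {fps R} fps_addA fps_addC fps_add0 fps_addN.

End FpsZmod.

Section FpsRing.
Variable R : comNzRingType.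
Implicit Types f g h : {fps R}.

Definition fpsC (c : R) : {fps R} := Fps (fun n => c *+ (n == 0%N)).
Definition fpsX : {fps R} := Fps (fun n => (n == 1%N)%:R).

Definition fps_mul f g : {fps R} :=
  Fps (fun n => \sum_(i < n.+1) fcoef f i * fcoef g (n - i)%N).

Definition fps_trunc (n : nat) f : {poly R} := \poly_(i < n.+1) fcoef f i.

Lemma fcoef_mul_trunc n k f g : (k <= n)%N ->
  fcoef (fps_mul f g) k = (fps_trunc n f * fps_trunc n g)`_k.
Proof.
move=> kn; rewrite coefM; apply: eq_bigr => i _; rewrite !coef_poly.
by rewrite !ltnS (leq_trans (leq_ord i) kn) (leq_trans (leq_subr i k) kn).
Qed.

Fact fps_mulC : commutative fps_mul.
Proof.
by move=> f g; apply: fpsP => n; rewrite !(fcoef_mul_trunc _ _ (leqnn n)) mulrC.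
Qed.

Fact fps_mulA : associative fps_mul.
Proof.
move=> f g h; apply: fpsP => n.
transitivity (fps_trunc n f * (fps_trunc n g * fps_trunc n h))`_n.
  rewrite coefM; apply: eq_bigr => i _.
  by rewrite (fcoef_mul_trunc _ _ (leq_subr i n)) coef_poly ltn_ord.
rewrite mulrA coefM; apply: eq_bigr => i _.
by rewrite (fcoef_mul_trunc _ _ (leq_ord i)) [in LHS]coef_poly ltnS leq_subr.
Qed.

Fact fps_mul1 : left_id (fpsC 1) fps_mul.
Proof.
move=> f; apply: fpsP => n /=; rewrite big_ord_recl /= subn0 mul1r big1 ?addr0//.
by move=> i _; rewrite mul0r.
Qed.

Fact fps_mulDl : left_distributive fps_mul +%R.
Proof.
move=> f g h; apply: fpsP => n /=; rewrite -big_split /=.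
by apply: eq_bigr => i _; rewrite mulrDl.
Qed.

Fact fps_oner_neq0 : fpsC 1 != 0.
Proof.
by apply/eqP => /(congr1 (fun f => fcoef f 0)) /eqP; rewrite /= oner_eq0.
Qed.

HB.instance Definition _ := GRing.Zmodule_isComNzRing.Build {fps R}
  fps_mulA fps_mulC fps_mul1 fps_mulDl fps_oner_neq0.

Definition fps_unit : pred {fps R} := fun f => `[< exists g, g * f = 1 >].
Definition fps_inv f : {fps R} := xget f [set g | g * f = 1].

Fact fps_mulVf : {in fps_unit, left_inverse 1 fps_inv *%R}.
Proof. by move=> f /asboolP; exact: (@xgetPex _ f [set g | g * f = 1]). Qed.

Fact fps_unitPl f g : g * f = 1 -> fps_unit f.
Proof. by move=> gf; apply/asboolP; exists g. Qed.

Fact fps_inv_out : {in [predC fps_unit], fps_inv =1 id}.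
Proof.
move=> f /asboolPn nf; apply: xgetPN => g /= gf; by apply: nf; exists g.
Qed.

HB.instance Definition _ := GRing.ComNzRing_hasMulInverse.Build {fps R}
  fps_mulVf fps_unitPl fps_inv_out.

(** [fps_pow N f] is [f(z^N)], for [N > 0]. *)
Definition fps_pow (N : nat) f : {fps R} :=
  Fps (fun k => if (N %| k)%N then fcoef f (k %/ N) else 0).

End FpsRing.

Section FpsIdomain.
Variable R : idomainType.

Lemma fps_order (f : {fps R}) : f != 0 ->
  exists2 n, fcoef f n != 0 & forall k, (k < n)%N -> fcoef f k = 0.
Proof.
move=> f0; have ex : exists n, fcoef f n != 0.
  apply: contrapT => nex; case/eqP: f0; apply: fpsP => n /=.
  by apply/eqP; apply/negPn/negP => fn; apply: nex; exists n.
exists (ex_minn ex); case: ex_minnP => // n fn nmin k kn.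
by apply/eqP; apply: contraTT kn => fk; rewrite -leqNgt nmin.
Qed.

Fact fps_idomain : GRing.integral_domain_axiom {fps R}.
Proof.
move=> f g fg; apply: contraT; rewrite negb_or => /andP[].
move=> /fps_order[m fm fm0] /fps_order[n gn gn0].
have /eqP := congr1 (fun h => fcoef h (m + n)) fg; apply: contraTT => _ /=.
have mlt : (m < (m + n).+1)%N by rewrite ltnS leq_addr.
rewrite (bigD1 (Ordinal mlt)) //= addKn big1 ?addr0 ?mulf_neq0// => i im.
case: (ltngtP i m) => [im'|mi|/eqP].
- by rewrite fm0 ?mul0r.
- rewrite gn0 ?mulr0//; move: (ltn_ord i); rewrite ltnS => ile.
  by rewrite ltn_subLR // ltn_add2r.
- by move=> E; case/eqP: im; apply: val_inj; apply/eqP.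
Qed.

HB.instance Definition _ :=
  GRing.ComUnitRing_isIntegral.Build {fps R} fps_idomain.

End FpsIdomain.

Definition step : choiceType := (int * int)%type.

Definition SC : seq step := [:: (1, 1); (1, -1); (2, 0)].
Definition vertical_steps : seq step := [:: (0, 2); (0, -2)].
Definition SCW : seq step := SC ++ vertical_steps.

Definition vertical (s : step) : bool := s \in vertical_steps.

Definition vertices (p : seq step) : seq step := 0 :: scanl +%R 0 p.
Definition terminus (p : seq step) : step := last 0 (vertices p).

Definition vconstrained (p : seq step) : bool :=
  all (mem SCW) p && sorted (fun s s' => ~~ (vertical s && vertical s')) p.

Definition paths_Q (n m : nat) : set (seq step) :=
  [set p | [/\ vconstrained p, all (fun v => 0 <= v.2) (vertices p)
             & terminus p = (n%:Z, m%:Z)]].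

Definition paths_QR (n m : nat) : set (seq step) :=
  [set p | paths_Q n m p /\ all (mem SC) (take 1 p)].

Lemma terminus_sum p : terminus p = \sum_(s <- p) s.
Proof.
have H a : last a (scanl +%R a p) = a + \sum_(s <- p) s.
  elim: p a => [|s p IHp] a /=; first by rewrite big_nil addr0.
  by rewrite IHp big_cons addrA.
by rewrite /terminus /= H add0r.
Qed.

Lemma size_vconstrained p : vconstrained p ->
  (size p)%:Z <= (terminus p).1 *+ 2 + (vertical (head 0 p))%:Z.
Proof.
rewrite /vconstrained terminus_sum => /andP[].
elim: p => [|s p IHp] /=; first by rewrite big_nil.
case/andP=> sS pS sp; have {IHp} := IHp pS (path_sorted sp).
rewrite big_cons; set S := \sum_(_ <- _) _ => IHp.
have hp : vertical s -> vertical (head 0 p) = false.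
  by move=> vs; case: p sp {pS S IHp} => //= s' p /andP[]; rewrite vs => /negbTE.
have [vs|nvs] := boolP (vertical s).
  rewrite {}hp //= in IHp; have -> : (s + S).1 = S.1 by
    move: vs; rewrite /vertical !inE => /orP[]/eqP->; rewrite /= add0r.
  by rewrite -addn1 PoszD lerD2r -[leRHS]addr0.
have s1 : 1 <= s.1.
  move: sS nvs; rewrite /SCW mem_cat /vertical => /orP[|->//].
  by rewrite !inE => /or3P[]/eqP->.
rewrite /= addr0 mulrnDl -addn1 PoszD addrC.
apply: (le_trans (y := 1 + (S.1 *+ 2 + 1))).
  by rewrite lerD2l (le_trans IHp)// lerD2l; case: vertical.
by rewrite [_ *+ 2 + 1]addrC addrA lerD2r -[1 + 1]/(1 *+ 2) lerMn2r.
Qed.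

Lemma finite_paths_Q n m : finite_set (paths_Q n m).
Proof.
pose L := fix L k : seq (seq step) :=
  if k is k'.+1 then [::] :: [seq s :: q | s <- SCW, q <- L k'] else [:: [::]].
have inL k p : all (mem SCW) p -> (size p <= k)%N -> p \in L k.
  elim: k p => [|k IHk] [|s p] // /andP[sS pS] pk.
  rewrite -[L k.+1]/([::] :: [seq s :: q | s <- SCW, q <- L k]) inE.
  by apply/orP; right; apply: (allpairs_f cons) => //; exact: IHk.
apply: sub_finite_set (finite_seq (L (n.*2.+1))) => p [pv _ pe].
apply: (inL n.*2.+1); first by case/andP: pv.
have := size_vconstrained pv; rewrite pe /= -[_ *+ 2]/(n%:Z + n%:Z) -PoszD.
rewrite -PoszD lez_nat addnn => /leq_trans; apply.
by rewrite -addn1 leq_add2l leq_b1.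
Qed.

(** These sets are finite (see [finite_paths_Q]), so [fset_set] loses nothing. *)
Definition CQ (n m : nat) : nat := #|` fset_set (paths_Q n m)|.
Definition CQR (n m : nat) : nat := #|` fset_set (paths_QR n m)|.

Notation "x %:F" := (FracField.tofrac x) : ring_scope.

Section Series.
Variables (R : comNzRingType) (N : nat).

(** With [t := fpsX R] and [x = t^N], these are [\sum_n c(n) x^n] in [R[[t]]]
    and [\sum_(n, m) c(n, m) x^n y^m] in [R[[t]][[y]]]. *)
Definition gser1 (c : nat -> nat) : {fps R} :=
  fps_pow N (Fps (fun n => (c n)%:R)).
Definition gser2 (c : nat -> nat -> nat) : {fps {fps R}} :=
  Fps (fun m => gser1 (fun n => c n m)).

End Series.

Definition K (A : comNzRingType) (x y : A) : A :=
  y ^+ 3 - x * (1 + x * y + y ^+ 2) * (1 + y ^+ 2 + y ^+ 4).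

(** Puiseux series in [x] with exponents in [(1/N) Z] are Laurent series in
    [t = x^(1/N)]; those that vanish as [x -> 0] are the power series in [t]
    without constant term. *)
Definition vanishing_root (F : comNzRingType) (N : nat) (s : {fps F}) : Prop :=
  K (fpsX F ^+ N) s = 0 /\ fcoef s 0 = 0.

(* Main.v *)
From HB Require Import structures.
Require Import Defs.
From mathcomp Require Import all_boot all_order all_algebra fraction finmap.
From mathcomp Require Import boolp classical_sets cardinality zify ring.

Import Order.TTheory GRing.Theory Num.Theory.

Local Open Scope ring_scope.

(** Kernel method. Let [Q] be the series of all paths, with or without the
    restriction on the first step, and [J] the series of those to which a
    vertical step may be appended. Removing the last step expresses [Q] through
    [J] and [J] through [Q]; eliminating [J] gives [K(x,y) Q = P(y)], where
    [P(y) = a y^5 - z y^4 + y^3 + p2 y^2 + p1 y - z], [z = x Q(x,0)], and [a] is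
    [0] under the restriction and [1] without it. The left-hand side vanishes at
    [y = s1, s2, s3], hence [P(y)] is the product of
    [(y - s1) (y - s2) (y - s3)] and a quadratic polynomial. Comparing the
    coefficients of [y^5], [y^4], [y^3] and [1] determines this quadratic
    polynomial, and [z] with it, although [p1] and [p2] are unknown. *)

(** * Counting paths by their last step *)

Definition paths_to (P : pred (seq step)) (e : step) : set (seq step) :=
  [set p | P p /\ terminus p = e].

Definition count_to (P : pred (seq step)) (e : step) : nat :=
  #|` fset_set (paths_to P e)|.

Lemma terminus_rcons p s : terminus (rcons p s) = terminus p + s.
Proof. by rewrite !terminus_sum big_rcons. Qed.

Lemma vertices_rcons p s :
  vertices (rcons p s) = rcons (vertices p) (terminus p + s).
Proof.
rewrite /vertices scanl_rcons rcons_cons -terminus_rcons /terminus /vertices.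
by rewrite scanl_rcons /= last_rcons.
Qed.

Lemma eq_count_to (P P' : pred (seq step)) e :
  (forall p, terminus p = e -> P p = P' p) -> count_to P e = count_to P' e.
Proof.
move=> PP'; congr #|` fset_set _|; apply/seteqP.
by split=> p [Pp pe]; split=> //; rewrite ?PP' // -PP'.
Qed.

Lemma count_to_eq0 (P : pred (seq step)) e :
  (forall p, terminus p = e -> ~~ P p) -> count_to P e = 0%N.
Proof.
move=> nP; rewrite /count_to (_ : paths_to P e = set0) ?fset_set0 //.
by apply/seteqP; split=> // p [Pp pe]; have := nP p pe; rewrite Pp.
Qed.

(** Finiteness matters because [fset_set] sends an infinite set to the empty one, and cardinals
    would then not add up. *)
Lemma count_to_split (P c : pred (seq step)) e : finite_set (paths_to P e) ->
  count_to P e = (count_to [pred p | P p && c p] e +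
                  count_to [pred p | P p && ~~ c p] e)%N.
Proof.
move=> finP; rewrite /count_to.
set A := paths_to [pred p | P p && c p] e.
set B := paths_to [pred p | P p && ~~ c p] e.
have finA : finite_set A.
  by apply: sub_finite_set finP => p [/andP[Pp _] pe].
have finB : finite_set B.
  by apply: sub_finite_set finP => p [/andP[Pp _] pe].
have -> : paths_to P e = (A `|` B)%classic.
  apply/seteqP; split=> p.
    move=> [Pp pe]; have [cp|ncp] := boolP (c p); [left|right];
    by split=> //=; rewrite Pp.
  by case=> -[/andP[Pp _] pe].
rewrite fset_setU // -cardfsUI -fset_setI //.
rewrite (_ : (A `&` B)%classic = set0) ?fset_set0 ?cardfs0 ?addn0 //.
apply/seteqP; split=> // p [[/andP[_ cp] _] [/andP[_]]].
by rewrite cp.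
Qed.

Lemma count_to_rcons_last (P : pred (seq step)) (s e : step) :
    finite_set (paths_to P e) ->
  count_to [pred p | P p && ((p != [::]) && (last 0 p == s))] e =
  count_to [pred p | P (rcons p s)] (e - s).
Proof.
move=> finP; rewrite /count_to.
set A := paths_to [pred p | P (rcons p s)] _.
have imA : paths_to [pred p | P p && ((p != [::]) && (last 0 p == s))] e =
           ((rcons^~ s) @` A)%classic.
  apply/seteqP; split=> [p|_ [p [/= Pp pe] <-]].
    case: p / (lastP p) => [|p s'] [/= /andP[Pp]] //.
    rewrite last_rcons => /andP[_ /eqP ss'] pe; subst s'.
    by exists p => //; split=> //=; rewrite -pe terminus_rcons addrK.
  split; last by rewrite terminus_rcons pe subrK.
  by rewrite /= Pp last_rcons eqxx andbT; case: (p).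
have finA : finite_set A.
  have injf : {in ((rcons^~ s) @^-1` paths_to P e)%classic &,
                 injective (rcons^~ s)}.
    by move=> p q _ _; exact: rcons_injl.
  apply: sub_finite_set (finite_preimage injf finP) => p [/= Pp pe].
  by split=> //; rewrite terminus_rcons pe subrK.
rewrite imA fset_set_image // card_imfset //=.
exact: rcons_injl.
Qed.

Lemma count_to_nil (P : pred (seq step)) e :
  count_to [pred p | P p && (p == [::])] e = P [::] && (e == 0) :> nat.
Proof.
have [/andP[P0 /eqP->]|ne] := boolP (P [::] && (e == 0)).
  rewrite /count_to (_ : paths_to _ _ = [set [::]]%classic).
    by rewrite fset_set1 cardfs1.
  apply/seteqP; split=> [p [/andP[_ /eqP]] //|_ ->].
  by split=> //=; rewrite P0.
apply: count_to_eq0 => p pe; apply/negP => /andP[Pp /eqP p0]; case/negP: ne.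
by rewrite -pe p0 in Pp *; rewrite Pp.
Qed.

(** Induction on [S] with [P] varying: the paths that end with the head of [S] are split off, and
    the predicate selecting the others fulfils the hypotheses for the tail. *)
Lemma count_to_rcons (P : pred (seq step)) (S : seq step) e :
    uniq S -> finite_set (paths_to P e) ->
    (forall p (s : step), P (rcons p s) -> s \in S) ->
  count_to P e = ((P [::] && (e == 0%R)) +
    \sum_(s <- S) count_to [pred p | P (rcons p s)] (e - s)%R)%N.
Proof.
elim: S P => [|s S IHS] P /=.
  move=> _ finP PS; rewrite big_nil addn0 -count_to_nil.
  apply: eq_count_to => p _ /=.
  case: p / (lastP p) => [|p s]; rewrite ?andbT //.
  by apply/idP/andP => [/PS|[]//].
move=> /andP[sS uS] finP PS; rewrite big_cons.
pose c p : bool := (p != [::]) && (last 0 p == s).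
rewrite (@count_to_split P c) // count_to_rcons_last // addnCA; congr (_ + _)%N.
rewrite IHS //=; first last.
- move=> p t /andP[/PS]; rewrite inE /c last_rcons => /orP[->|] //.
  by case: (p).
- by apply: sub_finite_set finP => p [/andP[Pp _] pe].
rewrite /c andbT; congr (_ + _)%N; apply: eq_big_seq => t tS.
apply: eq_count_to => p _ /=; rewrite last_rcons.
have -> : (t == s) = false by apply: contraNF sS => /eqP<-.
by rewrite andbF andbT.
Qed.

(** * Half-plane paths, where [b] switches the restriction on the first step *)

Definition hpath (b : bool) : pred (seq step) := fun p =>
  [&& vconstrained p, all (fun v => 0 <= v.2) (vertices p)
    & b ==> all (mem SC) (take 1 p)].

(* The paths in [hpath b] that a vertical step may prolong. *)
Definition hpathV (b : bool) : pred (seq step) := fun p =>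
  [&& hpath b p, ~~ vertical (last 0 p) & b ==> (p != [::])].

Lemma hpath_vconstrained b p : hpath b p -> vconstrained p.
Proof. by case/and3P. Qed.

Lemma hpath_terminus_ge0 b p :
  hpath b p -> 0 <= (terminus p).1 /\ 0 <= (terminus p).2.
Proof.
case/and3P=> vp /allP hp _; split; last first.
  by apply: hp; rewrite /terminus /vertices /= mem_last.
(* Twice the abscissa is at least [-1], so by integrality the abscissa is nonnegative. *)
have := size_vconstrained vp; rewrite mulr2n; case: vertical; lia.
Qed.

Lemma finite_hpath b e : finite_set (paths_to (hpath b) e).
Proof.
case: e => [[n|n] [m|m]].
- apply: sub_finite_set (finite_paths_Q n m) => p [/and3P[vp hp _] pe].
  by split.
all: apply: sub_finite_set (finite_set0 _) => p [/hpath_terminus_ge0[]].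
all: by move=> e1 e2 pe; rewrite pe in e1 e2.
Qed.

Lemma finite_hpathV b e : finite_set (paths_to (hpathV b) e).
Proof.
by apply: sub_finite_set (finite_hpath b e) => p [/and3P[hp _ _] pe].
Qed.

Lemma vconstrained_rcons p s : vconstrained (rcons p s) =
  [&& vconstrained p, s \in SCW & ~~ (vertical (last 0 p) && vertical s)].
Proof.
rewrite /vconstrained all_rcons /=; case: p => [|t p] /=.
  by rewrite andbT.
rewrite rcons_path /= -!andbA; do !bool_congr.
Qed.

Lemma hpath_rcons_SC b p s : s \in SC ->
  hpath b (rcons p s) = hpath b p && (0 <= (terminus p + s).2).
Proof.
move=> sS; rewrite /hpath vconstrained_rcons vertices_rcons all_rcons.
have -> : s \in SCW by rewrite mem_cat sS.
have -> : vertical s = false.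
  by move: sS; rewrite !inE => /or3P[]/eqP->.
have -> : all (mem SC) (take 1 (rcons p s)) = all (mem SC) (take 1 p).
  by case: p => [|t p] /=; rewrite ?take0 // andbT; exact: sS.
by rewrite andbF /= andbT -!andbA; do !bool_congr.
Qed.

Lemma hpath_rcons_vertical b p s : s \in vertical_steps ->
  hpath b (rcons p s) = hpathV b p && (0 <= (terminus p + s).2).
Proof.
move=> sS; rewrite /hpathV /hpath vconstrained_rcons vertices_rcons all_rcons.
have -> : s \in SCW by rewrite mem_cat sS orbT.
have -> : vertical s by [].
(* Appending a step changes the first step only for the empty path, and there a vertical step would
   break the restriction. *)
have -> : b ==> all (mem SC) (take 1 (rcons p s)) =
          (b ==> all (mem SC) (take 1 p)) && (b ==> (p != [::])).
  case: b p => [] [|t p] //=; last by rewrite !take0 andbT.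
  by move: sS; rewrite !inE => /orP[]/eqP->.
by rewrite /= andbT -!andbA; do !bool_congr.
Qed.

Lemma hpathV_rcons b p s :
  hpathV b (rcons p s) = (s \in SC) && hpath b (rcons p s).
Proof.
rewrite /hpathV last_rcons.
have -> : b ==> (rcons p s != [::]) by case: b p => [] [].
rewrite andbT; have [sS|nS] := boolP (s \in SC).
  by rewrite andbC /vertical; move: sS; rewrite !inE => /or3P[]/eqP->.
apply: contraNF nS => /andP[/hpath_vconstrained].
rewrite vconstrained_rcons mem_cat /vertical.
by case/and3P=> _ /orP[//|->].
Qed.

(** A path either ends with a vertical step, and then prolongs a path of [hpathV b], or belongs to
    [hpathV b] itself. The one exception is the empty path when [b] holds, whence the correction
    term. *)
Lemma count_hpath b (e : step) : 0 <= e.2 ->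
  count_to (hpath b) e = (count_to (hpathV b) e + (b && (e == 0%R)) +
    \sum_(s <- vertical_steps) count_to (hpathV b) (e - s)%R)%N.
Proof.
(* Both counts are expanded by the last step over [SCW]; the contributions of [SC] then agree, and
   the vertical ones vanish for [hpathV b]. *)
move=> e2; rewrite (@count_to_rcons _ SCW) ?(@count_to_rcons (hpathV b) SCW) //.
- rewrite /SCW !big_cat /= [X in (_ + (_ + X) + _)%N]big1_seq; last first.
    move=> s /= sS; apply: count_to_eq0 => p _; rewrite /= hpathV_rcons.
    by move: sS; rewrite !inE => /orP[]/eqP->.
  rewrite addn0 !addnA -[in RHS](addnAC _ (b && _)); congr (_ + _ + _)%N.
  + by rewrite /hpathV /hpath /=; case: b; case: (e == 0).
  + apply: eq_big_seq => s sS; apply: eq_count_to => p _.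
    by rewrite /= hpathV_rcons sS.
  apply: eq_big_seq => s sS; apply: eq_count_to => p pe.
  by rewrite /= hpath_rcons_vertical // pe subrK e2 andbT.
- exact: finite_hpathV.
- by move=> p s; rewrite hpathV_rcons mem_cat => /andP[->].
- exact: finite_hpath.
- by move=> p s /hpath_vconstrained; rewrite vconstrained_rcons => /and3P[].
Qed.

Lemma count_hpathV b (e : step) : 0 <= e.2 ->
  count_to (hpathV b) e = ((~~ b && (e == 0%R)) +
    \sum_(s <- SC) count_to (hpath b) (e - s)%R)%N.
Proof.
move=> e2; rewrite (@count_to_rcons (hpathV b) SC) //.
- congr (_ + _)%N.
    by rewrite /hpathV /hpath /=; case: b; case: (e == 0).
  apply: eq_big_seq => s sS; apply: eq_count_to => p pe.
  by rewrite /= hpathV_rcons sS hpath_rcons_SC // pe subrK e2 andbT.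
- exact: finite_hpathV.
- by move=> p s; rewrite hpathV_rcons => /andP[].
Qed.

(** * Recurrences for the counts at points with natural coordinates *)

Lemma count_hpath_eq0 b (e : step) :
  (e.1 < 0) || (e.2 < 0) -> count_to (hpath b) e = 0%N.
Proof.
move=> e0; apply: count_to_eq0 => p pe; apply: contraL e0.
by move=> /hpath_terminus_ge0; rewrite pe negb_or -!leNgt => -[-> ->].
Qed.

Lemma count_hpathV_eq0 b (e : step) :
  (e.1 < 0) || (e.2 < 0) -> count_to (hpathV b) e = 0%N.
Proof.
move=> e0; apply: count_to_eq0 => p pe; apply: contraL e0 => /and3P[].
by move=> /hpath_terminus_ge0; rewrite pe negb_or -!leNgt => -[-> ->].
Qed.

(** Multiplication by the variable, read on coefficients; the type is general so that it acts both
    on counts and on series. *)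
Definition shift {T : nmodType} (c : nat -> T) (n : nat) : T :=
  if n is k.+1 then c k else 0.

Definition nhpath b n m := count_to (hpath b) (n%:Z, m%:Z).
Definition nhpathV b n m := count_to (hpathV b) (n%:Z, m%:Z).

Lemma CQE : CQ = nhpath false.
Proof.
apply/funext => n; apply/funext => m.
congr #|` fset_set _|; apply/seteqP; split=> p.
  by move=> [vp hp pe]; split=> //; rewrite /hpath vp hp.
by move=> [/and3P[vp hp _] pe].
Qed.

Lemma CQRE : CQR = nhpath true.
Proof.
apply/funext => n; apply/funext => m.
congr #|` fset_set _|; apply/seteqP; split=> p.
  by move=> [[vp hp pe] fp]; split=> //; rewrite /hpath vp hp.
by move=> [/and3P[vp hp fp] pe]; split.
Qed.

(** The default value [0] of [shift] stands for the counts at points with a negative coordinate,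
    which vanish. *)
Lemma nhpath_rec b n m : nhpath b n m =
  (nhpathV b n m + [&& b, n == 0%N & m == 0%N] +
   (shift (shift (nhpathV b n)) m + nhpathV b n m.+2))%N.
Proof.
rewrite {1}/nhpath count_hpath // !big_cons big_nil addn0.
congr (_ + _ + (_ + _))%N.
  rewrite -[LHS]/(count_to (hpathV b) (n%:Z - 0, m%:Z - 2)) subr0.
  case: m => [|[|m]]; [exact: count_hpathV_eq0..|].
  by have -> : m.+2%:Z - 2 = m%:Z by lia.
rewrite -[LHS]/(count_to (hpathV b) (n%:Z - 0, m%:Z + 2)) subr0.
by rewrite -[m%:Z + 2]/(m + 2)%:Z addn2.
Qed.

Lemma nhpathV_rec b n m : nhpathV b n m =
  ([&& ~~ b, n == 0%N & m == 0%N] +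
   (shift (fun k => shift (nhpath b k) m) n +
   (shift (fun k => nhpath b k m.+1) n +
    shift (shift (fun k => nhpath b k m)) n)))%N.
Proof.
rewrite {1}/nhpathV count_hpathV // !big_cons big_nil addn0.
congr (_ + (_ + (_ + _)))%N.
- rewrite -[LHS]/(count_to (hpath b) (n%:Z - 1, m%:Z - 1)).
  case: n => [|n]; first by rewrite count_hpath_eq0.
  case: m => [|m]; first by rewrite count_hpath_eq0 ?orbT.
  by have [-> ->] : n.+1%:Z - 1 = n%:Z /\ m.+1%:Z - 1 = m%:Z by lia.
- rewrite -[LHS]/(count_to (hpath b) (n%:Z - 1, m%:Z + 1)).
  case: n => [|n]; first by rewrite count_hpath_eq0.
  by have [-> ->] : n.+1%:Z - 1 = n%:Z /\ m%:Z + 1 = m.+1%:Z by lia.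
rewrite -[LHS]/(count_to (hpath b) (n%:Z - 2, m%:Z - 0)) subr0.
case: n => [|[|n]]; [exact: count_hpath_eq0..|].
by have -> : n.+2%:Z - 2 = n%:Z by lia.
Qed.

(** * Coefficients of formal power series *)

Lemma fcoefD (V : zmodType) (f g : {fps V}) n :
  fcoef (f + g) n = fcoef f n + fcoef g n.
Proof. by []. Qed.

Lemma fcoefN (V : zmodType) (f : {fps V}) n : fcoef (- f) n = - fcoef f n.
Proof. by []. Qed.

Lemma shift0 (V : nmodType) (c : nat -> V) : shift c 0 = 0.
Proof. by []. Qed.

Lemma shiftS (V : nmodType) (c : nat -> V) n : shift c n.+1 = c n.
Proof. by []. Qed.

Section FpsCoef.
Variable R : comNzRingType.
Implicit Types f g : {fps R}.

Lemma fcoefC (a : R) n : fcoef (fpsC a) n = a *+ (n == 0%N).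
Proof. by []. Qed.

Lemma fcoefX n : fcoef (fpsX R) n = (n == 1%N)%:R.
Proof. by []. Qed.

Lemma fcoefM f g n :
  fcoef (f * g) n = \sum_(i < n.+1) fcoef f i * fcoef g (n - i)%N.
Proof. by []. Qed.

Lemma fcoefM0 f g : fcoef (f * g) 0 = fcoef f 0 * fcoef g 0.
Proof. by rewrite fcoefM big_ord1. Qed.

Lemma fcoefCM a f n : fcoef (fpsC a * f) n = a * fcoef f n.
Proof.
rewrite fcoefM big_ord_recl /= subn0 big1 ?addr0 //.
by move=> i _; rewrite mulr0n mul0r.
Qed.

Lemma fcoefXM f n : fcoef (fpsX R * f) n = shift (fcoef f) n.
Proof.
rewrite fcoefM big_ord_recl /= mul0r add0r; case: n => [|n].
  by rewrite big_ord0.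
rewrite big_ord_recl /= mul1r subSS subn0 big1 ?addr0 //.
by move=> i _; rewrite mul0r.
Qed.

Lemma fcoefXnM k f n :
  fcoef (fpsX R ^+ k * f) n = if (k <= n)%N then fcoef f (n - k) else 0.
Proof.
elim: k n => [|k IHk] n; first by rewrite expr0 mul1r subn0.
rewrite exprS -mulrA fcoefXM; by case: n => //= n; rewrite IHk ltnS subSS.
Qed.

Fact fpsC_is_zmod_morphism : zmod_morphism (@fpsC R).
Proof. by move=> a b; apply: fpsP => n; rewrite fcoefD fcoefN /= mulrnBl. Qed.

Fact fpsC_is_monoid_morphism : monoid_morphism (@fpsC R).
Proof.
split=> // a b; apply: fpsP => n.
by rewrite fcoefCM /= mulrnAr.
Qed.

HB.instance Definition _ :=
  GRing.isZmodMorphism.Build R {fps R} (@fpsC R) fpsC_is_zmod_morphism.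
HB.instance Definition _ :=
  GRing.isMonoidMorphism.Build R {fps R} (@fpsC R) fpsC_is_monoid_morphism.

Lemma fpsC_inj : injective (@fpsC R).
Proof. by move=> a b /(congr1 (fun f => fcoef f 0)). Qed.

Lemma fpsC_eq0 (a : R) : (fpsC a == 0) = (a == 0).
Proof. by rewrite -(inj_eq fpsC_inj) rmorph0. Qed.

Lemma fps0P f : fcoef f 0 = 0 -> exists g, f = fpsX R * g.
Proof.
move=> f0; exists (Fps (fun n => fcoef f n.+1)).
by apply: fpsP => -[|n]; rewrite fcoefXM.
Qed.

Lemma fps_XnM_eq0 f : (forall n, exists g, f = fpsX R ^+ n * g) -> f = 0.
Proof.
move=> fX; apply: fpsP => n; have [g ->] := fX n.+1.
by rewrite fcoefXnM ltnn.
Qed.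

End FpsCoef.

(* Substituting [s] for [y] in [(y - s) g = c], without having to define the
   substitution: comparing coefficients gives [c = - s^(n+1) g_n] for all [n]. *)
Lemma fps_small_root (R : comNzRingType) (s c : {fps R}) (g : {fps {fps R}}) :
    fcoef s 0 = 0 ->
  (fpsX {fps R} - fpsC s) * g = fpsC c -> c = 0.
Proof.
move=> /fps0P[s' ->{s}] E; apply: fps_XnM_eq0 => n.
set s := fpsX R * s' in E.
(* Since [s] is a multiple of the variable, divisibility by [s ^+ n] gives divisibility by the
   [n]-th power of the variable. *)
suff [h ->] : exists h, c = s ^+ n * h.
  by exists (s' ^+ n * h); rewrite exprMn mulrA.
have Ek k : shift (fcoef g) k - s * fcoef g k = c *+ (k == 0%N).
  have : fcoef ((fpsX {fps R} - fpsC s) * g) k = fcoef (fpsC c) k by rewrite E.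
  by rewrite mulrBl fcoefD fcoefN fcoefXM fcoefCM.
have g_rec k : fcoef g k = s * fcoef g k.+1.
  by apply/eqP; rewrite -subr_eq0; apply/eqP; have := Ek k.+1.
have gE k : fcoef g 0 = s ^+ k * fcoef g k.
  elim: k => [|k IHk]; first by rewrite expr0 mul1r.
  by rewrite IHk g_rec exprSr mulrA.
exists (- (s * fcoef g n)); have /= := Ek 0%N.
rewrite mulr1n add0r => <-; rewrite (gE n) mulrN; congr (- _).
by rewrite mulrCA.
Qed.

(** * Functional equations of the generating functions *)

Section GeneratingFunctions.
Variables (F : fieldType) (N : nat).
Hypothesis N0 : (0 < N)%N.

Local Notation x := (fpsX F ^+ N).
Local Notation y := (fpsX {fps F}).
Local Notation gs1 := (gser1 F N).
Local Notation gs2 := (gser2 F N).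

Lemma fcoef_gser2 c m : fcoef (gs2 c) m = gs1 (c^~ m).
Proof. by []. Qed.

Lemma gser1D c c' : gs1 (fun n => c n + c' n)%N = gs1 c + gs1 c'.
Proof.
by apply: fpsP => n; rewrite fcoefD /=; case: ifP; rewrite ?addr0 // natrD.
Qed.

Lemma gser1_delta (a : bool) : gs1 (fun n => a && (n == 0%N)) = a%:R.
Proof.
have -> : a%:R = fpsC (a%:R : F) by rewrite rmorph_nat.
apply: fpsP => n /=; case: (posnP n) => [->|n0].
  by rewrite dvdn0 div0n eqxx andbT.
rewrite mulr0n; case: ifP => // /dvdnP[k kn]; subst n.
by rewrite mulnK // (gtn_eqF (_ : 0 < k)%N) ?andbF //; case: k n0.
Qed.

Lemma gser1_shift c : gs1 (shift c) = x * gs1 c.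
Proof.
apply: fpsP => n; rewrite fcoefXnM /=; case: (leqP N n) => [Nn|nN].
  rewrite -{1 2}(subnK Nn) (dvdn_addl _ (dvdnn N)) divnDr // divnn N0 addn1.
  by [].
(* A multiple of [N] below [N] is [0], where [shift c] vanishes. *)
case: ifP => // /dvdnP[[|k] kn]; last by rewrite kn mulSn ltnNge leq_addr in nN.
by rewrite kn div0n.
Qed.

Lemma eq_gser1 c c' : c =1 c' -> gs1 c = gs1 c'.
Proof.
by move=> cc'; apply: fpsP => n /=; case: ifP => //; rewrite cc'.
Qed.

Variable b : bool.
Local Notation q m := (gs1 (fun n => nhpath b n m)).
Local Notation j m := (gs1 (fun n => nhpathV b n m)).

Lemma gser_hpath m :
  q m = j m + (b && (m == 0%N))%:R + (shift (shift (fun k => j k)) m + j m.+2).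
Proof.
rewrite (eq_gser1 _ _ (fun n => nhpath_rec b n m)) !gser1D.
congr (_ + _ + (_ + _)).
  rewrite -gser1_delta; apply: eq_gser1 => n.
  by rewrite andbA andbAC.
case: m => [|[|m]] //=; rewrite -[RHS](gser1_delta false); exact: eq_gser1.
Qed.

Lemma gser_hpathV m :
  j m = (~~ b && (m == 0%N))%:R +
    (x * shift (fun k => q k) m + (x * q m.+1 + x * (x * q m))).
Proof.
rewrite (eq_gser1 _ _ (fun n => nhpathV_rec b n m)) !gser1D !gser1_shift.
congr (_ + (x * _ + _)).
  rewrite -gser1_delta; apply: eq_gser1 => n.
  by rewrite andbA andbAC.
case: m => [|m] //=; rewrite -[RHS](gser1_delta false); exact: eq_gser1.
Qed.

(** Removal of a last vertical step. The factor [y * y] clears the [y^-2] of the step [(0, -2)]; the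
    subtracted terms belong to paths on the lines of height 0 and 1, which this step would take
    below the axis. *)
Lemma gser2_hpath :
  y * (y * gs2 (nhpath b)) =
  gs2 (nhpathV b) + y * (y * gs2 (nhpathV b))
  + y * (y * (y * (y * gs2 (nhpathV b)))) + b%:R * (y * y)
  - fpsC (j 0%N) - fpsC (j 1%N) * y.
Proof.
have -> : b%:R = fpsC (b%:R : {fps F}) by rewrite rmorph_nat.
apply: fpsP => -[|[|m]].
all: rewrite !(fcoefD, fcoefN, fcoefCM, fcoefXM, shift0, shiftS).
all: rewrite !(fcoefC, fcoefX, fcoef_gser2, eqxx, eqSS, mulr0n, mulr1n) /=.
- by rewrite !(mulr0, subr0, addr0) subrr.
- by rewrite !(mulr0, subr0, mulr1, addr0) subrr.
rewrite gser_hpath !(mulr0, subr0) -natrM mulnb.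
have -> : shift (fcoef (y * gs2 (nhpathV b))) m =
          shift (shift (fun k => j k)) m.
  by case: m => [|m] //; rewrite shiftS fcoefXM.
rewrite [RHS]addrAC -(addrA (j m.+2)) (addrC (j m.+2)) -[RHS]addrA.
by congr (_ + _); exact: addrC.
Qed.

(** Removal of a last step in [SC]. The factor [y] clears the [y^-1] of the step [(1, -1)], which is
    forbidden from height 0: hence the subtracted [x * q 0]. *)
Lemma gser2_hpathV :
  y * gs2 (nhpathV b) =
  (~~ b)%:R * y + fpsC x * (gs2 (nhpath b) + fpsC x * (y * gs2 (nhpath b))
    + y * (y * gs2 (nhpath b))) - fpsC (x * q 0%N).
Proof.
have -> : (~~ b)%:R = fpsC ((~~ b)%:R : {fps F}) by rewrite rmorph_nat.
apply: fpsP => -[|m].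
all: rewrite !(fcoefD, fcoefN, fcoefCM, fcoefXM, shift0, shiftS).
all: rewrite !(fcoefC, fcoefX, fcoef_gser2, eqxx, eqSS, mulr0n, mulr1n) /=.
  by rewrite !(mulr0, addr0, add0r) subrr.
rewrite gser_hpathV subr0 -natrM mulnb.
have -> : shift (fcoef (gs2 (nhpath b))) m = shift (fun k => q k) m.
  by case: m.
rewrite [x * (_ + _)]mulrDr [x * (_ + _)]mulrDr.
by congr (_ + _); rewrite addrC.
Qed.

End GeneratingFunctions.

(** * Elimination of [J] and specialization at a root of the kernel *)

Section KernelMethod.
Variable A : comNzRingType.
Implicit Types a b x y z s Q J : A.

(* The numerator left by the kernel equation; the unknown series enter through
   the coefficients [z], [p2] and [p1]. *)
Definition quintic a z p2 p1 y :=
  a * y ^+ 5 - z * y ^+ 4 + y ^+ 3 + p2 * y ^+ 2 + p1 * y - z.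

(** After multiplication by [y], the first relation involves [J] only through
    [(1 + y^2 + y^4) (y J)], and the second one gives [y J]. The condition on [a + b] makes the
    coefficient of [y^3] equal to 1 in both cases. *)
Lemma kernel_equation a b x y Q J z j0 j1 : a + b = 1 ->
  y * (y * Q) = J + y * (y * J) + y * (y * (y * (y * J))) + b * (y * y)
                - j0 - j1 * y ->
  y * J = a * y + x * (Q + x * (y * Q) + y * (y * Q)) - z ->
  K x y * Q = quintic a z (- (z + j1)) (a - j0) y.
Proof.
move=> ab QE JE.
have xE : x * (Q + x * (y * Q) + y * (y * Q)) = y * J - a * y + z.
  by rewrite JE; ring.
transitivity (y * (y * (y * Q)) -
    (1 + y ^+ 2 + y ^+ 4) * (x * (Q + x * (y * Q) + y * (y * Q)))).
  by rewrite /K; ring.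
rewrite xE QE (_ : b = 1 - a) /quintic; last by rewrite -ab addrC addKr.
ring.
Qed.

(** Both [K(x,y) - K(x,s)] and [P(y) - P(s)] are multiples of [y - s], where [P] is the quintic. As
    [K(x,s) = 0], the kernel equation makes [P(s)] such a multiple too, without any substitution in
    [Q]. *)
Lemma quintic_small_root a z p2 p1 x y s Q :
    K x y * Q = quintic a z p2 p1 y -> K x s = 0 ->
  exists G, (y - s) * G = quintic a z p2 p1 s.
Proof.
move=> KQ Ks.
(* Each [dk] is the quotient of [y^k - s^k] by [y - s]; [K1] and [P1] are the resulting quotients
   for the kernel and the quintic. *)
pose d2 := y + s.
pose d3 := y * d2 + s ^+ 2.
pose d4 := y * d3 + s ^+ 3.
pose d5 := y * d4 + s ^+ 4.
pose d6 := y * d5 + s ^+ 5.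
pose K1 := d3 - x * (x + 2 * d2 + x * d3 + 2 * d4 + x * d5 + d6).
pose P1 := a * d5 - z * d4 + d3 + p2 * d2 + p1.
have KE : K x y = (y - s) * K1.
  rewrite -[LHS]subr0 -Ks /K /K1 /d6 /d5 /d4 /d3 /d2; ring.
exists (K1 * Q - P1); rewrite mulrBr mulrA -KE KQ.
rewrite /quintic /P1 /d5 /d4 /d3 /d2; ring.
Qed.

End KernelMethod.

Arguments quintic {A}.

(** * Factorization of a quintic with three known roots *)

Section QuinticRoots.
Variables (A : idomainType) (a z p2 p1 r1 r2 r3 : A).
Hypothesis r12 : r1 != r2.
Hypothesis r13 : r1 != r3.
Hypothesis r23 : r2 != r3.
Local Notation P := (quintic a z p2 p1).
Hypothesis Pr1 : P r1 = 0.
Hypothesis Pr2 : P r2 = 0.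
Hypothesis Pr3 : P r3 = 0.

Let e1 := r1 + r2 + r3.
Let e2 := r1 * r2 + r1 * r3 + r2 * r3.
Let e3 := r1 * r2 * r3.
Let Delta := 1 + e3 * e1.
(** The polynomial [e1 ^+ 2 - e2] is the complete homogeneous symmetric polynomial of degree 2 in
    the roots. *)
Let B := 1 + a * (e1 ^+ 2 - e2).

(* Newton interpolation: the first three divided differences of [P] vanish. *)
Lemma quintic_factor y : P y = (y - r1) * (y - r2) * (y - r3) *
  (a * (e1 ^+ 2 - e2 + e1 * y + y ^+ 2) - z * (e1 + y) + 1).
Proof.
(* The quotient of [P u - P v] by [u - v], written out since no division is available in [A]. *)
pose D u v := a * (u ^+ 4 + u ^+ 3 * v + u ^+ 2 * v ^+ 2 + u * v ^+ 3 + v ^+ 4)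
  - z * (u ^+ 3 + u ^+ 2 * v + u * v ^+ 2 + v ^+ 3) + (u ^+ 2 + u * v + v ^+ 2)
  + p2 * (u + v) + p1.
have D0 u v : u != v -> P u = 0 -> P v = 0 -> D u v = 0.
  move=> uv Pu Pv; have : (u - v) * D u v = P u - P v.
    by rewrite /quintic /D; ring.
  by move=> /eqP; rewrite Pu Pv subr0 mulf_eq0 subr_eq0 (negbTE uv) /= => /eqP.
have D12 := D0 _ _ r12 Pr1 Pr2; have D13 := D0 _ _ r13 Pr1 Pr3.
pose D3 := a * (r1 ^+ 3 + r2 ^+ 3 + r3 ^+ 3 + r1 ^+ 2 * r2 + r1 ^+ 2 * r3
    + r2 ^+ 2 * r1 + r2 ^+ 2 * r3 + r3 ^+ 2 * r1 + r3 ^+ 2 * r2 + r1 * r2 * r3)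
  - z * (r1 ^+ 2 + r2 ^+ 2 + r3 ^+ 2 + r1 * r2 + r1 * r3 + r2 * r3)
  + (r1 + r2 + r3) + p2.
have D30 : D3 = 0.
  have : (r2 - r3) * D3 = D r1 r2 - D r1 r3 by rewrite /D /D3; ring.
  by move=> /eqP; rewrite D12 D13 subr0 mulf_eq0 subr_eq0 (negbTE r23) /= => /eqP.
(* Newton's form of [P]. The last factor is the divided difference at [r1], [r2], [r3] and [y],
   where [y^5], [y^4] and [y^3] contribute complete homogeneous polynomials of degrees 2, 1 and
   0. *)
transitivity (P r1 + D r1 r2 * (y - r1) + D3 * ((y - r1) * (y - r2))
  + (y - r1) * (y - r2) * (y - r3) *
    (a * (e1 ^+ 2 - e2 + e1 * y + y ^+ 2) - z * (e1 + y) + 1)).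
  by rewrite /quintic /D /D3 /e1 /e2; ring.
by rewrite Pr1 D12 D30 !mul0r !add0r.
Qed.

(** At [y = 0] the factorization is a linear equation in [z], with [z] on both sides; collecting
    these terms produces [Delta]. *)
Lemma quintic_constant : z * Delta = e3 * B.
Proof.
have := quintic_factor 0; rewrite /quintic => E.
have {}E : - z = - e3 * (a * (e1 ^+ 2 - e2) - z * e1 + 1).
  transitivity (a * 0 ^+ 5 - z * 0 ^+ 4 + 0 ^+ 3 + p2 * 0 ^+ 2 + p1 * 0 - z).
    by ring.
  by rewrite E /e3; ring.
have -> : z * Delta = - (- z) + z * e3 * e1 by rewrite /Delta; ring.
by rewrite E /B; ring.
Qed.

(** Multiplying by [Delta] eliminates [z] without a division. The constant coefficient collapses to
    [B] because [Delta - e3 * e1 = 1]. *)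
Lemma quintic_factor_Delta y :
  Delta * P y = (y - r1) * (y - r2) * (y - r3) *
    (B + (a * e1 * Delta - e3 * B) * y + a * Delta * y ^+ 2).
Proof.
rewrite quintic_factor mulrCA; congr (_ * _).
have -> : Delta * (a * (e1 ^+ 2 - e2 + e1 * y + y ^+ 2) - z * (e1 + y) + 1) =
  Delta * (a * (e1 ^+ 2 - e2 + e1 * y + y ^+ 2) + 1) - (z * Delta) * (e1 + y).
  by ring.
by rewrite quintic_constant /B /Delta; ring.
Qed.

End QuinticRoots.

(** * The kernel equation for the path series *)

Lemma rmorph_K (A B : comNzRingType) (f : {rmorphism A -> B}) x y :
  f (K x y) = K (f x) (f y).
Proof.
by rewrite /K !(rmorphB, rmorphM, rmorphD, rmorphXn, rmorph1).
Qed.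

Lemma rmorph_quintic (A B : comNzRingType) (f : {rmorphism A -> B})
    a z p2 p1 y :
  f (quintic a z p2 p1 y) = quintic (f a) (f z) (f p2) (f p1) (f y).
Proof.
by rewrite /quintic !(rmorphB, rmorphM, rmorphD, rmorphXn).
Qed.

Lemma rmorph_Delta (A B : comNzRingType) (f : {rmorphism A -> B}) s1 s2 s3 :
  f (1 + s1 * s2 * s3 * (s1 + s2 + s3)) =
  1 + f s1 * f s2 * f s3 * (f s1 + f s2 + f s3).
Proof. by rewrite !(rmorphM, rmorphD, rmorph1). Qed.

Section RootSeries.
Variables (F : fieldType) (N : nat) (b : bool).
Hypothesis N0 : (0 < N)%N.

Let a : {fps F} := (~~ b)%:R.
Let z : {fps F} := fpsX F ^+ N * gser1 F N (fun n => nhpath b n 0).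
Let p2 := - (z + gser1 F N (fun n => nhpathV b n 1)).
Let p1 := a - gser1 F N (fun n => nhpathV b n 0).

Lemma kernel_hpath :
  K (fpsC (fpsX F ^+ N)) (fpsX {fps F}) * gser2 F N (nhpath b) =
  quintic (fpsC a) (fpsC z) (fpsC p2) (fpsC p1) (fpsX {fps F}).
Proof.
rewrite /p2 /p1 rmorphN rmorphD rmorphB; apply: kernel_equation; first last.
- by rewrite /a rmorph_nat; exact: gser2_hpathV.
- exact: gser2_hpath.
by rewrite /a rmorph_nat; case: (b); rewrite ?addr0 ?add0r.
Qed.

(** The value of the quintic at [s] is free of [y] and a multiple of [y - s]; as [s] has no constant
    term, it must vanish. *)
Lemma quintic_vanishing_root s : vanishing_root N s -> quintic a z p2 p1 s = 0.
Proof.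
case=> Ks s0.
have [|G GE] := quintic_small_root _ _ _ _ _ _ _ (fpsC s) _ kernel_hpath.
  by rewrite -rmorph_K Ks rmorph0.
by apply: (fps_small_root _ s _ G) => //; rewrite GE rmorph_quintic.
Qed.

End RootSeries.

(** * Passage to the field of fractions *)

Section HpathSeries.
Variables (F : fieldType) (N : nat) (b : bool) (s1 s2 s3 : {fps F}).
Hypothesis N0 : (0 < N)%N.
Hypothesis s_uniq : uniq [:: s1; s2; s3].
Hypothesis s1_root : vanishing_root N s1.
Hypothesis s2_root : vanishing_root N s2.
Hypothesis s3_root : vanishing_root N s3.

(** Bundled as a morphism so that polynomial identities between series can be transported; it
    unfolds to the embedding of the theorem. *)
Let inj : {rmorphism {fps F} -> {fraction {fps {fps F}}}} :=
  @FracField.tofrac {fps {fps F}} \o @fpsC {fps F}.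
Let x := inj (fpsX F ^+ N).
Let y : {fraction {fps {fps F}}} := (fpsX {fps F})%:F.
Let a : {fraction {fps {fps F}}} := (~~ b)%:R.
Let r1 := inj s1.
Let r2 := inj s2.
Let r3 := inj s3.
Let e1 := r1 + r2 + r3.
Let e2 := r1 * r2 + r1 * r3 + r2 * r3.
Let e3 := r1 * r2 * r3.
Let Delta := 1 + e3 * e1.
Let B := 1 + a * (e1 ^+ 2 - e2).

Let inj_inj : injective inj.
Proof.
by move=> u v /eqP; rewrite /inj /= tofrac_eq => /eqP/fpsC_inj.
Qed.

Let r_neq : [/\ r1 != r2, r1 != r3 & r2 != r3].
Proof.
move: s_uniq; rewrite /= !inE negb_or andbT => /andP[/andP[s12 s13] s23].
by split; rewrite (inj_eq inj_inj).
Qed.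

Let root_quintic s : vanishing_root N s ->
  quintic a (x * inj (gser1 F N (fun n => nhpath b n 0)))
    (inj (- (fpsX F ^+ N * gser1 F N (fun n => nhpath b n 0)
             + gser1 F N (fun n => nhpathV b n 1))))
    (inj ((~~ b)%:R - gser1 F N (fun n => nhpathV b n 0))) (inj s) = 0.
Proof.
move=> /(quintic_vanishing_root _ _ b N0)/(congr1 inj).
by rewrite rmorph_quintic rmorph_nat rmorph0 rmorphM.
Qed.

Lemma hpath_series0 :
  x * inj (gser1 F N (fun n => nhpath b n 0)) * Delta = e3 * B.
Proof.
have [r12 r13 r23] := r_neq.
exact: (quintic_constant _ _ _ _ _ _ _ _ r12 r13 r23 (root_quintic _ s1_root)
  (root_quintic _ s2_root) (root_quintic _ s3_root)).
Qed.

Lemma hpath_series : Delta * (K x y * (gser2 F N (nhpath b))%:F) =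
  (y - r1) * (y - r2) * (y - r3) *
    (B + (a * e1 * Delta - e3 * B) * y + a * Delta * y ^+ 2).
Proof.
have [r12 r13 r23] := r_neq.
apply: etrans (quintic_factor_Delta _ _ _ _ _ _ _ _ r12 r13 r23
  (root_quintic _ s1_root) (root_quintic _ s2_root) (root_quintic _ s3_root) _).
congr (_ * _); have /(congr1 (@FracField.tofrac _)) := kernel_hpath F N b N0.
by rewrite rmorphM rmorph_K rmorph_quintic /= !rmorph_nat rmorphM /= rmorphM.
Qed.

End HpathSeries.

(** * Solving for the two series *)

Section SolveForSeries.
Variables (L : fieldType) (a x y Q q k r1 r2 r3 : L).

Let e1 := r1 + r2 + r3.
Let e2 := r1 * r2 + r1 * r3 + r2 * r3.
Let e3 := r1 * r2 * r3.
Let Delta := 1 + e3 * e1.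
Let B := 1 + a * (e1 ^+ 2 - e2).

Hypothesis k0 : k != 0.
Hypothesis x0 : x != 0.
Hypothesis Delta0 : Delta != 0.
Hypothesis QE : Delta * (k * Q) = (y - r1) * (y - r2) * (y - r3) *
    (B + (a * e1 * Delta - e3 * B) * y + a * Delta * y ^+ 2).
Hypothesis qE : x * q * Delta = e3 * B.

Lemma solve_series0 : q = e3 * B / (x * Delta).
Proof. by rewrite -qE (mulrAC x) mulrC mulKf // mulf_neq0. Qed.

Lemma solve_series : Q = - (r1 - y) * (r2 - y) * (r3 - y) / (Delta * k) *
    (B + (a * e1 * Delta - e3 * B) * y + a * Delta * y ^+ 2).
Proof.
have -> : - (r1 - y) * (r2 - y) * (r3 - y) = (y - r1) * (y - r2) * (y - r3).
  by ring.
by rewrite mulrAC -QE mulrA mulrC mulKf // mulf_neq0.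
Qed.

End SolveForSeries.

Section SolveSpecialCases.
Variables (L : fieldType) (x y Q q k r1 r2 r3 : L).

Let e1 := r1 + r2 + r3.
Let e2 := r1 * r2 + r1 * r3 + r2 * r3.
Let e3 := r1 * r2 * r3.
Let Delta := 1 + e3 * e1.
Let B a := 1 + a * (e1 ^+ 2 - e2).

Hypothesis k0 : k != 0.
Hypothesis x0 : x != 0.
Hypothesis Delta0 : Delta != 0.

(** Here [a = 0], so that [B 0 = 1] and the quadratic factor is [1 - e3 * y]. *)
Lemma solve_restricted :
  Delta * (k * Q) = (y - r1) * (y - r2) * (y - r3) *
    (B 0 + (0 * e1 * Delta - e3 * B 0) * y + 0 * Delta * y ^+ 2) ->
  Q = - (r1 - y) * (r2 - y) * (r3 - y) * (1 - e3 * y) / (Delta * k).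
Proof.
move=> QE; rewrite (solve_series _ _ _ _ _ _ _ _ k0 Delta0 QE) mulrAC.
by congr (_ * _ / _); rewrite /B -/e3; ring.
Qed.

Lemma solve_restricted0 :
  x * q * Delta = e3 * B 0 -> q = e3 / (x * Delta).
Proof.
move=> qE; rewrite (solve_series0 _ _ _ _ _ _ _ x0 Delta0 qE).
by rewrite mul0r addr0 mulr1.
Qed.

Hypothesis two0 : 2 != 0 :> L.

Let half_sum_sqr : e1 ^+ 2 - e2 =
  2^-1 * ((r1 + r2) ^+ 2 + (r1 + r3) ^+ 2 + (r2 + r3) ^+ 2).
Proof. by rewrite /e1 /e2; field. Qed.

(** Here [a = 1]; expanding [Delta] and [B 1], the terms in [e3 * e1 ^+ 2] cancel in the coefficient
    of [y]. *)
Lemma solve_unrestricted :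
  Delta * (k * Q) = (y - r1) * (y - r2) * (y - r3) *
    (B 1 + (1 * e1 * Delta - e3 * B 1) * y + 1 * Delta * y ^+ 2) ->
  Q = - (r1 - y) * (r2 - y) * (r3 - y) / (Delta * k)
      * (1 + 2^-1 * ((r1 + r2) ^+ 2 + (r1 + r3) ^+ 2 + (r2 + r3) ^+ 2)
         + (e1 + e3 * (e2 - 1)) * y + Delta * y ^+ 2).
Proof.
move=> QE; rewrite (solve_series _ _ _ _ _ _ _ _ k0 Delta0 QE) -half_sum_sqr.
by congr (_ * _); rewrite /B -/e1 -/e2 -/e3 -/Delta /Delta; ring.
Qed.

Lemma solve_unrestricted0 :
  x * q * Delta = e3 * B 1 ->
  q = e3 * (1 + 2^-1 * ((r1 + r2) ^+ 2 + (r1 + r3) ^+ 2 + (r2 + r3) ^+ 2))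
      / (x * Delta).
Proof.
move=> qE; rewrite (solve_series0 _ _ _ _ _ _ _ x0 Delta0 qE).
by rewrite mul1r -half_sum_sqr.
Qed.

End SolveSpecialCases.

(** * Nonvanishing of the denominators *)

Section Nonzero.
Variables (F : fieldType) (N : nat) (s1 s2 s3 : {fps F}).
Hypothesis s1_root : vanishing_root N s1.

Lemma fpsXn_neq0 : fpsX F ^+ N != 0.
Proof.
rewrite expf_neq0 //; apply/eqP => /(congr1 (fun f => fcoef f 1)) /eqP.
by rewrite /= oner_eq0.
Qed.

(** The constant term is 1, because that of [s1] is zero. *)
Lemma Delta_neq0 : 1 + s1 * s2 * s3 * (s1 + s2 + s3) != 0.
Proof.
apply/eqP => /(congr1 (fun f => fcoef f 0)) /eqP.
rewrite fcoefD !fcoefM0; case: s1_root => _ ->.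
by rewrite !mul0r addr0 oner_eq0.
Qed.

(** The coefficient of degree 0 in [y] is [-x]. *)
Lemma K_neq0 : K (fpsC (fpsX F ^+ N)) (fpsX {fps F}) != 0.
Proof.
apply/eqP => /(congr1 (fun f => fcoef f 0)) /eqP.
rewrite /K fcoefD fcoefN -!mulrA fcoefCM exprS fcoefXM fcoefM0 !fcoefD.
rewrite !exprS !fcoefXM fcoefCM !fcoefX.
by rewrite !(addr0, mulr0, mulr1, add0r) oppr_eq0 (negbTE fpsXn_neq0).
Qed.

End Nonzero.

Theorem theorem24 (F : numClosedFieldType) (N : nat) (s1 s2 s3 : {fps F}) :
  (0 < N)%N ->
  uniq [:: s1; s2; s3] ->
  vanishing_root N s1 -> vanishing_root N s2 -> vanishing_root N s3 ->
  let inj (a : {fps F}) : {fraction {fps {fps F}}} := (fpsC a)%:F in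
  let x := inj (fpsX F ^+ N) in
  let y : {fraction {fps {fps F}}} := (fpsX {fps F})%:F in
  let r1 := inj s1 in
  let r2 := inj s2 in
  let r3 := inj s3 in
  let Delta := 1 + r1 * r2 * r3 * (r1 + r2 + r3) in
  [/\ (gser2 F N CQR)%:F =
        - (r1 - y) * (r2 - y) * (r3 - y) * (1 - r1 * r2 * r3 * y)
          / (Delta * K x y),
      (gser2 F N CQ)%:F =
        - (r1 - y) * (r2 - y) * (r3 - y) / (Delta * K x y)
          * (1 + 2^-1 * ((r1 + r2) ^+ 2 + (r1 + r3) ^+ 2 + (r2 + r3) ^+ 2)
             + (r1 + r2 + r3
                + r1 * r2 * r3 * (r1 * r2 + r1 * r3 + r2 * r3 - 1)) * y
             + Delta * y ^+ 2),
      inj (gser1 F N (CQR^~ 0%N)) = r1 * r2 * r3 / (x * Delta)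
    & inj (gser1 F N (CQ^~ 0%N)) =
        r1 * r2 * r3
          * (1 + 2^-1 * ((r1 + r2) ^+ 2 + (r1 + r3) ^+ 2 + (r2 + r3) ^+ 2))
          / (x * Delta)].
Proof.
move=> N0 s_uniq s1_root s2_root s3_root inj x y r1 r2 r3 Delta.
have x0 : x != 0.
  by rewrite /x /inj tofrac_eq0 fpsC_eq0 fpsXn_neq0.
have k0 : K x y != 0.
  by rewrite /x /y /inj -rmorph_K tofrac_eq0 K_neq0.
have Delta0 : Delta != 0.
  rewrite -[Delta](rmorph_Delta _ _ (@FracField.tofrac _ \o @fpsC {fps F})) /=.
  by rewrite tofrac_eq0 fpsC_eq0 (Delta_neq0 _ _ _ _ _ s1_root).
have two0 : 2 != 0 :> {fraction {fps {fps F}}}.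
  have -> : 2 = inj (fpsC 2) by rewrite /inj !rmorph_nat.
  rewrite /inj tofrac_eq0 fpsC_eq0 fpsC_eq0.
  by rewrite pnatr_eq0.
rewrite CQE CQRE.
have Q b := hpath_series F N b s1 s2 s3 N0 s_uniq s1_root s2_root s3_root.
have q b := hpath_series0 F N b s1 s2 s3 N0 s_uniq s1_root s2_root s3_root.
split.
(* The coefficient [(~~ b)%:R] computes to [0] for [true] and to [1] for [false], as the special
   cases require. *)
- exact: (solve_restricted _ _ _ _ _ _ _ k0 Delta0 (Q true)).
- exact: (solve_unrestricted _ _ _ _ _ _ _ k0 Delta0 two0 (Q false)).
- exact: (solve_restricted0 _ _ _ _ _ _ x0 Delta0 (q true)).
exact: (solve_unrestricted0 _ _ _ _ _ _ x0 Delta0 two0 (q false)).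
Qed.
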